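(* If $X$ is a normed linear space of non-trivial cotype and $\operatorname{dens}X\ge\omega_\omega$, then for no set $\Gamma$ does $X$ admit a uniform embedding into $c_0(\Gamma)$, and for no set $\Gamma$ does $X$ admit a coarse embedding into $c_0(\Gamma)$.
   Context: Non-trivial cotype means Rademacher cotype $q$ for some $2\le q<\infty$. $\operatorname{dens}X$ is the density character of $X$ (the least cardinality of a dense subset). Let $f\colon (M,\rho)\to(N,\sigma)$ be a mapping between metric spaces. It is a coarse embedding (not necessarily one-to-one) if: for every $d>0$ there is $K\ge0$ such that $\sigma(f(x),f(y))\le K$ whenever $\rho(x,y)\le d$; and for every $K>0$ there is $d>0$ such that $\sigma(f(x),f(y))\ge K$ whenever $\rho(x,y)\ge d$. It is a uniform embedding if it is one-to-one and both $f$ and $f^{-1}$ (defined on $f(M)$) are uniformly continuous. $c_0(\Gamma)$ is the Banach space of scalar functions $x$ on $\Gamma$ such that $\{\gamma\in\Gamma:|x(\gamma)|>\varepsilon\}$ is finite for every $\varepsilon>0$, with the supremum norm. *)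

(* Defs.v *)
From HB Require Import structures.
From mathcomp Require Import all_boot all_order all_algebra.
From mathcomp Require Import complex.
From mathcomp Require Import all_classical all_reals all_analysis.
Set Implicit Arguments.
Unset Strict Implicit.
Unset Printing Implicit Defensive.
Import Order.TTheory GRing.Theory Num.Theory.
Import numFieldNormedType.Exports.
Local Open Scope classical_set_scope.
Local Open Scope card_scope.
Local Open Scope ring_scope.

Variant scalar_kind := RealScalars | ComplexScalars.

Definition scalars (R : realType) (k : scalar_kind) : numFieldType :=
  match k with
  | RealScalars => (R : numFieldType)
  | ComplexScalars => (R[i] : numFieldType)
  end.

(* In a [normedModType K] the norm is K-valued. For K = C its values are
   nonnegative reals embedded in C; [scalar_re] recovers them in R. *)
Definition scalar_re (R : realType) (k : scalar_kind) : scalars R k -> R :=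
  match k with
  | RealScalars => fun a => a
  | ComplexScalars => fun a => complex.Re a
  end.

Definition scalar_of (R : realType) (k : scalar_kind) : R -> scalars R k :=
  match k with
  | RealScalars => fun r => r
  | ComplexScalars => fun r => Complex r 0
  end.

Definition rnorm (R : realType) (k : scalar_kind)
    (V : normedZmodType (scalars R k)) (v : V) : R := scalar_re `|v|.

Definition normdist (R : realType) (k : scalar_kind)
    (V : normedZmodType (scalars R k)) (x y : V) : R := rnorm (x - y).

Section ScalarTheory.
Context (R : realType) (k : scalar_kind).
Implicit Types a b : scalars R k.

Lemma scalar_of_re a : 0 <= a -> scalar_of k (scalar_re a) = a.
Proof.
case: k a => //= -[x y]; rewrite lecE /= => /andP[/eqP + _].
by move=> ->.
Qed.

Lemma scalar_re0 : scalar_re (0 : scalars R k) = 0.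
Proof. by case: k. Qed.

Lemma scalar_of0 : scalar_of k (0 : R) = 0.
Proof. by case: k. Qed.

Lemma scalar_reD a b : scalar_re (a + b) = scalar_re a + scalar_re b.
Proof. by case: k a b => // -[? ?] [? ?]. Qed.

Lemma scalar_re_le a b : a <= b -> scalar_re a <= scalar_re b.
Proof. by case: k a b => //= a b; rewrite lecE => /andP[]. Qed.

Lemma le_scalar_of (r s : R) : (scalar_of k r <= scalar_of k s) = (r <= s).
Proof. by case: k => //=; rewrite lecE /= eqxx. Qed.

Lemma scalar_ofD (r s : R) : scalar_of k (r + s) = scalar_of k r + scalar_of k s.
Proof. by case: k => //=; apply/eqP; rewrite eq_complex /= eqxx addr0 eqxx. Qed.

Lemma scalar_ofM (r s : R) : scalar_of k (r * s) = scalar_of k r * scalar_of k s.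
Proof.
case: k => //=; apply/eqP; rewrite eq_complex /=.
by rewrite mulr0 subr0 mulr0 mul0r addr0 !eqxx.
Qed.

Lemma scalar_of_inj : injective (@scalar_of R k).
Proof. by case: k => // r s /= []. Qed.

Lemma rnorm_ge0 (V : normedZmodType (scalars R k)) (v : V) : 0 <= rnorm v.
Proof. by rewrite -scalar_re0; exact: scalar_re_le. Qed.

Lemma rnormK (V : normedZmodType (scalars R k)) (v : V) :
  scalar_of k (rnorm v) = `|v|.
Proof. by apply: scalar_of_re. Qed.

Lemma rnormD (V : normedZmodType (scalars R k)) (v w : V) :
  rnorm (v + w) <= rnorm v + rnorm w.
Proof. by rewrite -scalar_reD; apply: scalar_re_le; exact: ler_normD. Qed.

Lemma rnorm0_eq0 (V : normedZmodType (scalars R k)) (v : V) :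
  rnorm v = 0 -> v = 0.
Proof. by move=> v0; apply: normr0_eq0; rewrite -rnormK v0 scalar_of0. Qed.

Lemma rnorm0 (V : normedZmodType (scalars R k)) : rnorm (0 : V) = 0.
Proof. by rewrite /rnorm normr0 scalar_re0. Qed.

Lemma rnormM a b : rnorm (a * b) = rnorm a * rnorm b.
Proof. by apply: scalar_of_inj; rewrite scalar_ofM !rnormK normrM. Qed.

End ScalarTheory.

Section C0.
Context (R : realType) (k : scalar_kind) (Gamma : Type).
Local Notation K := (scalars R k).

Definition vanishing : {pred Gamma -> K^o} := fun x =>
  `[< forall e : R, 0 < e -> finite_set [set g | e < rnorm (x g)] >].

Lemma vanishing_submod : submod_closed vanishing.
Proof.
split.
  apply/asboolP => e e0; rewrite (_ : [set _ | _] = set0) //.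
  by apply/seteqP; split => // g /=; rewrite rnorm0 ltNge ltW.
move=> a x y /asboolP vx /asboolP vy; apply/asboolP => e e0.
have e2 : 0 < e / 2 by rewrite divr_gt0.
have a1 : 0 < rnorm a + 1 by rewrite ltr_wpDl// rnorm_ge0.
have ea : 0 < e / 2 / (rnorm a + 1) by rewrite divr_gt0.
apply: (@sub_finite_set _ _ ([set g | e / 2 / (rnorm a + 1) < rnorm (x g)] `|`
                            [set g | e / 2 < rnorm (y g)])); last first.
  by rewrite finite_setU; split; [exact: vx | exact: vy].
move=> g /= eg; apply: contrapT => /not_orP[/negP + /negP].
rewrite -!leNgt => xg yg; move: eg; apply/negP; rewrite -leNgt.
apply: (le_trans (rnormD _ _)); rewrite [leRHS](splitr e) lerD//.
apply: (le_trans _ (_ : (rnorm a + 1) * rnorm (x g) <= _)).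
  by rewrite [leLHS]rnormM ler_wpM2r ?rnorm_ge0// lerDl.
by rewrite mulrC -ler_pdivlMr.
Qed.

HB.instance Definition _ := GRing.isSubmodClosed.Build K _ vanishing
  vanishing_submod.

Record c0 := C0 { c0_fun :> Gamma -> K^o ; _ : c0_fun \in vanishing }.

HB.instance Definition _ := [isSub for c0_fun].
HB.instance Definition _ := [Choice of c0 by <:].
HB.instance Definition _ := [SubChoice_isSubLmodule of c0 by <:].

(* For Gamma empty, [sup set0 = 0]. *)
Definition supnorm (x : c0) : R := sup (range (fun g => rnorm (x g))).

Lemma c0_has_ubound (x : c0) : has_ubound (range (fun g => rnorm (x g))).
Proof.
have /asboolP/(_ 1 ltr01) F : vanishing x by case: x.
pose G := finmap.enum_fset
  (fset_set (range (fun g => rnorm (x g)) `&` [set r | 1 < r])).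
have FG : finite_set (range (fun g => rnorm (x g)) `&` [set r | 1 < r]).
  apply: sub_finite_set (finite_image (fun g => rnorm (x g)) F).
  by move=> r [[g _ <-] /= g1]; exists g.
exists (\big[Num.max/1]_(r <- G) r) => _ [g _ <-].
have [g1|g1] := leP (rnorm (x g)) 1.
  by apply: (le_trans g1); exact: bigmax_ge_id.
apply: (@Order.TotalTheory.le_bigmax_seq _ _ _ _ _ _ xpredT id) => //.
by rewrite in_fset_set// inE; split => //; exists g.
Qed.

Lemma le_supnorm (x : c0) g : rnorm (x g) <= supnorm x.
Proof. by apply: ub_le_sup; [exact: c0_has_ubound | exists g]. Qed.

Lemma supnorm_le (x : c0) r :
  0 <= r -> (forall g, rnorm (x g) <= r) -> supnorm x <= r.
Proof.
move=> r0 xr; rewrite /supnorm.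
have [->|/set0P ne] := eqVneq (range (fun g => rnorm (x g))) set0.
  by rewrite sup0.
by apply: ge_sup => // _ [g _ <-].
Qed.

Lemma supnorm_ge0 (x : c0) : 0 <= supnorm x.
Proof.
rewrite /supnorm; have [->|/set0P[_ [g _ _]]] :=
  eqVneq (range (fun g => rnorm (x g))) set0; first by rewrite sup0.
exact: le_trans (rnorm_ge0 _) (le_supnorm x g).
Qed.

Let c0_norm (x : c0) : K := scalar_of k (supnorm x).

Let c0_normD (x y : c0) : c0_norm (x + y) <= c0_norm x + c0_norm y.
Proof.
rewrite -scalar_ofD le_scalar_of; apply: supnorm_le => [|g].
  by rewrite addr_ge0 ?supnorm_ge0.
apply: (le_trans (rnormD (x g) (y g))).
by apply: lerD; exact: le_supnorm.
Qed.

Let supnormZ_le (a : K) (x : c0) : supnorm (a *: x) <= rnorm a * supnorm x.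
Proof.
apply: supnorm_le => [|g]; first by rewrite mulr_ge0 ?rnorm_ge0 ?supnorm_ge0.
by rewrite [leLHS]rnormM ler_wpM2l ?rnorm_ge0 ?le_supnorm.
Qed.

Let c0_normZ (a : K) (x : c0) : c0_norm (a *: x) = `|a| * c0_norm x.
Proof.
rewrite -rnormK -scalar_ofM; congr scalar_of; apply/eqP.
rewrite eq_le supnormZ_le /=.
have [->|a0] := eqVneq a 0; first by rewrite rnorm0 mul0r supnorm_ge0.
have ra0 : rnorm a != 0 by apply: contra_neq a0; exact: rnorm0_eq0.
rewrite -ler_pdivlMl; last by rewrite lt0r ra0 rnorm_ge0.
have -> : (rnorm a)^-1 = rnorm a^-1.
  apply: (mulfI ra0); rewrite mulfV// -rnormM mulfV//.
  by apply: (@scalar_of_inj R k); rewrite rnormK normr1; case: k.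
by rewrite -{1}(scalerK a0 x); exact: supnormZ_le.
Qed.

Let c0_norm0 (x : c0) : c0_norm x = 0 -> x = 0.
Proof.
rewrite /c0_norm -(scalar_of0 R k) => /scalar_of_inj x0.
apply: val_inj; apply/funext => g; apply: rnorm0_eq0; apply/eqP.
by rewrite eq_le rnorm_ge0 andbT -x0 le_supnorm.
Qed.

HB.instance Definition _ :=
  Lmodule_isNormed.Build K c0 c0_normD c0_normZ c0_norm0.

Lemma rnorm_c0E (x : c0) : rnorm x = supnorm x.
Proof. by apply: (@scalar_of_inj R k); rewrite rnormK. Qed.

End C0.

(* Rademacher cotype q; the average over signs is the expectation of
   Rademacher variables. *)
Definition cotype (R : realType) (k : scalar_kind)
    (X : normedModType (scalars R k)) (q : R) : Prop :=
  exists C : R, forall (n : nat) (x : 'I_n -> X),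
    (\sum_(i < n) rnorm (x i) `^ q) `^ q^-1 <=
    C * ((2 ^+ n)^-1 * \sum_(e : {ffun 'I_n -> bool})
           rnorm (\sum_(i < n) (-1) ^+ e i *: x i) `^ q) `^ q^-1.

Definition nontrivial_cotype (R : realType) (k : scalar_kind)
    (X : normedModType (scalars R k)) : Prop :=
  exists2 q : R, 2 <= q & cotype X q.

(* |A| = aleph_n; |A| = aleph_(n+1) says that |A| is the least cardinal
   greater than aleph_n, smaller cardinals being represented by subsets of A. *)
Fixpoint card_aleph (T : Type) (n : nat) (A : set T) : Prop :=
  match n with
  | 0%N => A #= [set: nat]
  | m.+1 => exists B : set T, [/\ B `<=` A, card_aleph m B, ~ (A #<= B) &
              forall C : set T, C `<=` A -> ~ (A #<= C) -> C #<= B]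
  end.

(* |A| = aleph_omega, the least cardinal above all the aleph_n. *)
Definition card_aleph_omega (T : Type) (A : set T) : Prop :=
  let above_alephs (C : set T) :=
    forall n, exists2 B : set T, B `<=` C & card_aleph n B in
  above_alephs A /\
  forall C : set T, C `<=` A -> above_alephs C -> A #<= C.

(* The cardinality of D is the density character of T. *)
Definition attains_dens (T : topologicalType) (D : set T) : Prop :=
  dense D /\ forall E : set T, dense E -> D #<= E.

Definition dens_ge_aleph_omega (T : topologicalType) : Prop :=
  exists D : set T, attains_dens D /\
    exists2 A : set T, A `<=` D & card_aleph_omega A.

(* Meaningful when rho and sigma are metrics on M and N. *)
Definition coarse_embedding (R : realType) (M N : Type)
    (rho : M -> M -> R) (sigma : N -> N -> R) (f : M -> N) : Prop :=
  (forall d, 0 < d -> exists2 K, 0 <= K &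
     forall x y, rho x y <= d -> sigma (f x) (f y) <= K) /\
  (forall K, 0 < K -> exists2 d, 0 < d &
     forall x y, d <= rho x y -> K <= sigma (f x) (f y)).

Definition uniform_embedding (R : realType) (M N : Type)
    (rho : M -> M -> R) (sigma : N -> N -> R) (f : M -> N) : Prop :=
  [/\ injective f,
      forall e, 0 < e -> exists2 d, 0 < d &
        forall x y, rho x y < d -> sigma (f x) (f y) < e
    & forall e, 0 < e -> exists2 d, 0 < d &
        forall x y, sigma (f x) (f y) < d -> rho x y < e].

(* Main.v *)
Require Import Defs.
From mathcomp Require Import all_boot all_order all_algebra.
From mathcomp Require Import complex lra zify.
From mathcomp Require Import all_classical all_reals all_analysis.
Set Implicit Arguments.
Unset Strict Implicit.
Unset Printing Implicit Defensive.
Import Order.TTheory GRing.Theory Num.Theory.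
Import numFieldNormedType.Exports.
Local Open Scope classical_set_scope.
Local Open Scope card_scope.
Local Open Scope ring_scope.

(* Rounding the coordinates of c0(Gamma) to multiples of K, and to zero when
   they are at most 3K, colours X through g : X -> c0(Gamma) so that points of
   the same colour have images within 6K, while, if g moves points at distance
   at most 1 by at most K, every unit ball of X carries finitely many colours.
   X contains 1/2-separated subsets of its unit ball of cardinality aleph_n for
   each n. Picking two elements from each of n+1 such sets of increasing
   cardinalities, one finds a cube of 2^(n+1) sums of one element from each
   pair, all of the same colour: each element a of the largest set comes with
   a lower-dimensional cube that is monochromatic for the colouring translated
   by a, infinitely many a share the same cube, and two of these have the same
   colour at one vertex. The differences of antipodal vertices are the sums
   with signs of n+1 vectors of norm at least 1/2; if points with images within
   6K are at bounded distance, these sums are bounded independently of n, which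
   contradicts cotype. *)

(** * Cardinal arithmetic *)

(** Choice picks a value for each point of [A]. With a relation instead of a function, a value can
    be described through witnesses. *)
Lemma card_le_rel (T U : Type) (A : set T) (B : set U) (G : T -> U -> Prop) :
  (forall x, A x -> exists2 y, B y & G x y) ->
  (forall x x' y, A x -> A x' -> G x y -> G x' y -> x = x') -> A #<= B.
Proof.
move=> totG injG; apply/card_leP.
have /choice[f fP] : forall x : A, exists y : B, G (set_val x) (set_val y).
  move=> x; have [y By Gy] := totG _ (set_valP x).
  by exists (SigSub (mem_set By)).
have f_inj : set_inj [set: A] f.
  move=> x y _ _ fxy; apply: val_inj.
  apply: (injG _ _ (set_val (f x))); try exact: set_valP; first exact: fP.
  by rewrite fxy; exact: fP.
by apply/injfunPex; exists f.
Qed.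

(** [u0] serves as value outside [A], so that later codings compose total functions rather than maps
    between subtypes. *)
Lemma card_le_fun (T U : Type) (u0 : U) (A : set T) (B : set U) : A #<= B ->
  exists f : T -> U, (forall x, A x -> B (f x)) /\
    (forall x x', A x -> A x' -> f x = f x' -> x = x').
Proof.
move=> /card_leP/injfunPex[h _ h_inj].
have /choice[f fP] : forall x, exists y : U,
    A x -> exists2 a : A, x = set_val a & y = set_val (h a).
  move=> x; have [Ax|nAx] := pselect (A x); last by exists u0.
  exists (set_val (h (SigSub (mem_set Ax)))) => _.
  by exists (SigSub (mem_set Ax)).
exists f; split=> [x /fP[a _ ->]|x x' /fP[a -> ->] /fP[a' -> ->] /val_inj].
  exact: set_valP.
by move=> aa'; rewrite (h_inj _ _ (in_setT a) (in_setT a') aa').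
Qed.

(** Zorn's lemma for graphs of partial injections: a maximal graph covers [A] or covers [B], since
    otherwise a pair of uncovered points could be added. *)
Lemma card_le_total (T U : Type) (A : set T) (B : set U) : A #<= B \/ B #<= A.
Proof.
pose P (G : set (T * U)) :=
  (forall x y, G (x, y) -> A x /\ B y) /\
  (forall x y x' y', G (x, y) -> G (x', y') -> x = x' <-> y = y').
have [|G [[GAB Ginj] Gmax]] := @Zorn_bigcup _ P.
  move=> F FP Ftot; split=> [x y [X FX] /(FP _ FX).1//|].
  move=> x y x' y' [X FX Xxy] [Y FY Yxy].
  have [XY|YX] := Ftot _ _ FX FY.
  - exact: (FP _ FY).2 (XY _ Xxy) Yxy.
  - exact: (FP _ FX).2 Xxy (YX _ Yxy).
have [domG|/existsNP[a /not_implyP[Aa aG]]] :=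
    pselect (forall x, A x -> exists y, G (x, y)).
  left; apply: (@card_le_rel _ _ _ _ (fun x y => G (x, y))).
    by move=> x /domG[y Gxy]; exists y => //; have [] := GAB _ _ Gxy.
  by move=> x x' y _ _ /Ginj/[apply] ->.
right; apply: (@card_le_rel _ _ _ _ (fun y x => G (x, y))) => [y By|];
  last first.
  by move=> y y' x _ _ /Ginj/[apply] <-.
have [[x Gxy]|yG] := pselect (exists x, G (x, y)).
  by exists x => //; have [] := GAB _ _ Gxy.
exfalso; apply: (Gmax (G `|` [set (a, y)])).
  split; first exact: subsetUl.
  by move=> /(_ (a, y) (or_intror erefl)) Gay; apply: aG; exists y.
split=> [x z [/GAB//|[-> ->]//]|x z x' z'].
move=> [Gxz|[-> ->]] [Gxz'|[-> ->]] //; first exact: Ginj.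
- split=> e; exfalso; first by apply: aG; exists z; rewrite -e.
  by apply: yG; exists x; rewrite -e.
- split=> e; exfalso; first by apply: aG; exists z'; rewrite e.
  by apply: yG; exists x'; rewrite e.
Qed.

(* Zorn's lemma on the graphs of injections Y * Y -> Y, for Y containing a fixed
   countable set. For a maximal Y, either the complement of Y injects into Y, or
   Y has a disjoint copy Y' and the injection extends to Y `|` Y', mapping the
   new pairs into Y'. *)
Lemma infinite_pairing (U : Type) : infinite_set [set: U] ->
  exists p : U -> U -> U,
    forall x y x' y', p x y = p x' y' -> x = x' /\ y = y'.
Proof.
move=> Uinf; have [u0 _] := infinite_setN0 Uinf.
have [nu [_ nu_injT]] := card_le_fun u0 ((infiniteP _).1 Uinf).
have {nu_injT}nu_inj : injective nu by move=> m n; exact: nu_injT.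
(* The carrier is read off the diagonal. [P G] then says that every pair from it has a value in it
   and that distinct pairs share no value. *)
pose dom (G : set (U * U * U)) : set U := [set x | exists z, G (x, x, z)].
pose P (G : set (U * U * U)) :=
  [/\ forall x y, dom G x -> dom G y -> exists z, G (x, y, z),
      forall x y z, G (x, y, z) -> [/\ dom G x, dom G y & dom G z] &
      forall x y x' y' z, G (x, y, z) -> G (x', y', z) -> x = x' /\ y = y'].
pose G0 : set (U * U * U) :=
  [set t | exists m n, t = (nu m, nu n, nu (pickle (m, n)))].
have domG0 n : dom G0 (nu n) by exists (nu (pickle (n, n))), n, n.
have PG0 : P G0.
  split=> [x y [_ [m [? [-> _ _]]]] [_ [n [? [-> _ _]]]]|x y z|x y x' y' z].
  - by exists (nu (pickle (m, n))), m, n.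
  - by move=> [m [n [-> -> ->]]].
  - move=> [m [n [-> -> ->]]] [m' [n' [-> ->]]] /nu_inj.
    by move=> /(pcan_inj pickleK)[-> ->].
(* Joining [G0] to each graph makes the empty chain admissible and keeps the range of [nu] in every
   carrier. *)
have [|G [[totG domG injG] Gmax]] := @Zorn_bigcup _ (fun G => P (G0 `|` G)).
  move=> F FP Ftot; set FG := \bigcup_(X in F) X.
  have in2 t t' : (G0 `|` FG) t -> (G0 `|` FG) t' -> exists X,
      [/\ X `<=` G0 `|` FG, P X, X t & X t'].
    have sub X : F X -> G0 `|` X `<=` G0 `|` FG.
      by move=> FX; apply: setUS; exact: bigcup_sup.
    move=> [Gt|[X FX Xt]] [Gt'|[Y FY Yt']].
    - by exists G0; split => //; exact: subsetUl.
    - by exists (G0 `|` Y); split; [exact: sub|exact: FP|left|right].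
    - by exists (G0 `|` X); split; [exact: sub|exact: FP|right|left].
    - have [XY|YX] := Ftot _ _ FX FY.
        exists (G0 `|` Y).
        by split; [exact: sub|exact: FP|right; exact: XY|right].
      exists (G0 `|` X).
      by split; [exact: sub|exact: FP|right|right; exact: YX].
  split=> [x y [z Gz] [z' Gz']|x y z Gt|x y x' y' z Gt Gt'].
  - have [X [XF [totX _ _] Xz Xz']] := in2 _ _ Gz Gz'.
    have [||w Xw] := totX x y; [by exists z|by exists z'|].
    by exists w; exact: XF.
  - have [X [XF [_ domX _] Xt _]] := in2 _ _ Gt Gt.
    have [[u ?] [v ?] [w ?]] := domX _ _ _ Xt.
    by split; [exists u|exists v|exists w]; exact: XF.
  - have [X [XF [_ _ injX] Xt Xt']] := in2 _ _ Gt Gt'.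
    exact: injX Xt Xt'.
set G1 := G0 `|` G in totG domG injG; pose Y := dom G1.
have Y0 n : Y (nu n) by have [z Gz] := domG0 n; exists z; left.
have /choice[g gP] : forall t : U * U, exists z, Y t.1 -> Y t.2 -> G1 (t, z).
  move=> [x y] /=; have [[Yx Yy]|nY] := pselect (Y x /\ Y y).
    by have [z Gz] := totG _ _ Yx Yy; exists z.
  by exists x => Yx Yy; case: nY.
have gY x y : Y x -> Y y -> Y (g (x, y)).
  by move=> Yx Yy; have [] := domG _ _ _ (gP (x, y) Yx Yy).
have g_inj x y x' y' : Y x -> Y y -> Y x' -> Y y' ->
    g (x, y) = g (x', y') -> x = x' /\ y = y'.
  move=> Yx Yy Yx' Yy' e; apply: injG (gP (x, y) Yx Yy) _.
  by rewrite e; exact: gP.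
pose nub (b : bool) := nu b.
have nub_inj : injective nub by move=> [] [] // /nu_inj.
have nubY b : Y (nub b) by exact: Y0.
have [le_YZ|le_ZY] := card_le_total Y (~` Y); last first.
  have [r [rY r_inj]] := card_le_fun (nu 0%N) le_ZY.
  (* [h] injects the whole type into [Y]: the second component of the pair tells [Y] from its
     complement. *)
  pose h x := if pselect (Y x) then g (x, nub true) else g (r x, nub false).
  have hY x : Y (h x).
    by rewrite /h; case: pselect => [Yx|nYx]; apply: gY => //; exact: rY.
  have h_inj : injective h.
    move=> x y; rewrite /h; case: pselect => Yx; case: pselect => Yy /=.
    - by move=> /g_inj[].
    - by move=> /g_inj[] //; [exact: rY|move=> _ /nub_inj].
    - by move=> /g_inj[] //; [exact: rY|move=> _ /nub_inj].
    - move=> /g_inj[]; [exact: rY|exact: nubY|exact: rY|exact: nubY|].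
      by move=> /r_inj ->.
  exists (fun x y => g (h x, h y)) => x y x' y' /g_inj[] //.
  by move=> /h_inj -> /h_inj ->.
exfalso; have [r [rZ r_inj]] := card_le_fun (nu 0%N) le_YZ.
pose Y' := r @` Y.
have YY' x : Y' x -> ~ Y x by move=> [y Yy <-]; exact: rZ.
have /choice[b bP] : forall x, exists y,
    (Y `|` Y') x -> Y y /\ x = (if `[<Y x>] then y else r y).
  move=> x; have [|nx] := pselect ((Y `|` Y') x); last by exists x.
  move=> [Yx|[y Yy <-]].
  - by exists x; rewrite asboolT.
  - by exists y; rewrite asboolF //; exact: rZ.
have Yb u v : Y (g (nub u, nub v)) by exact: gY.
(* [b x] is the point of [Y] that [x] comes from; the tag records which of the two copies [x] and
   [y] lie in. *)
pose tag x y := g (nub `[<Y x>], nub `[<Y y>]).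
pose code x y := r (g (g (b x, b y), tag x y)).
have codeY' x y : (Y `|` Y') x -> (Y `|` Y') y -> Y' (code x y).
  move=> /bP[? _] /bP[? _]; exists (g (g (b x, b y), tag x y)) => //.
  exact: gY (gY _ _ _ _) (Yb _ _).
have code_inj x y x' y' : (Y `|` Y') x -> (Y `|` Y') y -> (Y `|` Y') x' ->
    (Y `|` Y') y' -> code x y = code x' y' -> x = x' /\ y = y'.
  move=> /bP[Yx xE] /bP[Yy yE] /bP[Yx' xE'] /bP[Yy' yE'] e.
  have Yg := gY _ _ Yx Yy; have Yg' := gY _ _ Yx' Yy'.
  have [bxy nxy] := g_inj _ _ _ _ Yg (Yb _ _) Yg' (Yb _ _)
    (r_inj _ _ (gY _ _ Yg (Yb _ _)) (gY _ _ Yg' (Yb _ _)) e).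
  have [bx yb] := g_inj _ _ _ _ Yx Yy Yx' Yy' bxy.
  have [/nub_inj ex /nub_inj ey] :=
    g_inj _ _ _ _ (nubY _) (nubY _) (nubY _) (nubY _) nxy.
  by rewrite xE xE' yE yE' bx yb ex ey.
pose G' : set (U * U * U) := [set t | exists x y,
  [/\ (Y `|` Y') x, (Y `|` Y') y, ~ (Y x /\ Y y) & t = (x, y, code x y)]].
have dG' : G0 `|` (G `|` G') = G1 `|` G' by rewrite setUA.
have domE x : dom (G1 `|` G') x <-> (Y `|` Y') x.
  split=> [[z [Gz|[y [y' [Yy Yy' _ [-> _ _]]]]]]|[[z Gz]|Yx]] //.
  - by left; exists z.
  - by exists z; left.
  - exists (code x x); right; exists x, x; split=> //; [by right|by right|].
    by move=> [Yx' _]; exact: YY' Yx Yx'.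
apply: (Gmax (G `|` G')).
  split; first exact: subsetUl.
  have Y'n : Y' (r (nu 0%N)) by exists (nu 0%N).
  move=> /(_ (r (nu 0%N), nu 0%N, code (r (nu 0%N)) (nu 0%N))) GG.
  have /GG Gc : (G `|` G') (r (nu 0%N), nu 0%N, code (r (nu 0%N)) (nu 0%N)).
    right; exists (r (nu 0%N)), (nu 0%N); split=> //; [by right|by left|].
    by move=> [Yr _]; exact: YY' Yr.
  by apply: (YY' _ Y'n); have [] := domG _ _ _ (or_intror Gc).
rewrite dG'; split=> [x y /domE Yx /domE Yy|x y z|x y x' y' z].
- have [[{}Yx {}Yy]|nY] := pselect (Y x /\ Y y).
    by have [z Gz] := totG _ _ Yx Yy; exists z; left.
  by exists (code x y); right; exists x, y.
- move=> [/domG[Yx Yy Yz]|[? [? [Yx Yy _ [-> -> ->]]]]].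
    by split; apply/domE; left.
  by split; apply/domE => //; right; exact: codeY'.
- move=> [Gz|[? [? [Yx Yy _ [-> -> ->]]]]] [Gz'|[? [? [Yx' Yy' _ [-> ->]]]]].
  + exact: injG Gz Gz'.
  + move=> zE; exfalso; have [_ _ Yz] := domG _ _ _ Gz.
    by apply: (YY' z) => //; rewrite zE; exact: codeY'.
  + exfalso; have [_ _ Yz] := domG _ _ _ Gz'.
    by apply: (YY' _ _ Yz); exact: codeY'.
  + exact: code_inj.
Qed.

Lemma infinite_set_type (T : Type) (A : set T) :
  infinite_set A -> infinite_set [set: A].
Proof.
rewrite !infiniteP => /card_le_trans; apply.
by rewrite (card_le_eqr (card_setT A)).
Qed.

Lemma card_le_square (T : Type) (A : set T) : infinite_set A -> A `*` A #<= A.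
Proof.
move=> /infinite_set_type/infinite_pairing[p p_inj].
apply: (@card_le_rel _ _ _ _ (fun t z => exists x y : A,
  t = (set_val x, set_val y) /\ z = set_val (p x y))).
  move=> [x y] [/= Ax Ay].
  pose x' : A := SigSub (mem_set Ax); pose y' : A := SigSub (mem_set Ay).
  by exists (set_val (p x' y')); [exact: set_valP|exists x', y'].
move=> t t' z _ _ [x [y [-> ->]]] [x' [y' [-> /val_inj]]].
by move=> /p_inj[-> ->].
Qed.

Definition seqs (T : eqType) (A : set T) : set (seq T) :=
  [set s : seq T | forall x : T, x \in s -> A x].

(** Pairing the entries one after the other codes a sequence in [W]. The code determines the
    sequence once its length is known, so the length is paired with it. *)
Lemma card_seqs (T : eqType) (U : Type) (A : set T) (W : set U) :
  infinite_set W -> A #<= W -> seqs A #<= W.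
Proof.
move=> Winf AW; have [w0 Ww0] := infinite_setN0 Winf.
have [f [fW f_inj]] := card_le_fun w0 AW.
have [nu [nuW nu_inj]] := card_le_fun w0 ((infiniteP _).1 Winf).
have [p [pW p_inj]] := card_le_fun w0 (card_le_square Winf).
pose enc := foldr (fun x w => p (f x, w)) w0.
have encW s : seqs A s -> W (enc s).
  elim: s => //= x s IHs xsA; apply: pW; split=> /=.
    by apply: fW; apply: xsA; rewrite mem_head.
  by apply: IHs => y ys; apply: xsA; rewrite inE ys orbT.
have enc_inj s s' : seqs A s -> seqs A s' -> size s = size s' ->
    enc s = enc s' -> s = s'.
  elim: s s' => [|x s IHs] [|x' s'] //= xsA xsA' [ss'] e.
  have Ax : A x by apply: xsA; rewrite mem_head.
  have Ax' : A x' by apply: xsA'; rewrite mem_head.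
  have sA : seqs A s by move=> y ys; apply: xsA; rewrite inE ys orbT.
  have sA' : seqs A s' by move=> y ys; apply: xsA'; rewrite inE ys orbT.
  have : (f x, enc s) = (f x', enc s').
    by apply: p_inj e; split => /=; by [exact: fW|exact: encW].
  by move=> [/(f_inj _ _ Ax Ax') -> /(IHs _ sA sA' ss') ->].
apply: (@card_le_rel _ _ _ _ (fun s w => w = p (nu (size s), enc s))).
  move=> s As; eexists; last reflexivity.
  by apply: pW; split; [exact: nuW|exact: encW].
move=> s s' _ As As' -> e.
have : (nu (size s), enc s) = (nu (size s'), enc s').
  by apply: p_inj e; split; [exact: nuW|exact: encW|exact: nuW|exact: encW].
by move=> [/(nu_inj _ _ I I) ss' es]; exact: enc_inj.
Qed.

(** If all fibres were finite, pairing the value of [h] with an index inside the fibre would inject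
    [A] into the square of [B]. *)
Lemma infinite_fiber (T U W : Type) (A : set T) (B : set W) (h : T -> U) :
  infinite_set B -> ~ (A #<= B) -> h @` A #<= B ->
  exists u, infinite_set (A `&` h @^-1` [set u]).
Proof.
move=> Binf AB hAB; apply/not_existsP => fin; apply: AB.
have [w0 _] := infinite_setN0 Binf.
have [f [fB f_inj]] := card_le_fun w0 hAB.
have [nu [nuB nu_inj]] := card_le_fun w0 ((infiniteP _).1 Binf).
have /choice[g gP] : forall u, exists g : T -> nat, forall x x',
    (A `&` h @^-1` [set u]) x -> (A `&` h @^-1` [set u]) x' ->
    g x = g x' -> x = x'.
  move=> u; have /contrapT/finite_set_countable := fin u.
  by move=> /(card_le_fun 0%N)[g [_ ginj]]; exists g.
apply: card_le_trans (card_le_square Binf).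
apply: (@card_le_rel _ _ _ _ (fun x w => w = (f (h x), nu (g (h x) x)))).
  move=> x Ax; eexists; last reflexivity.
  by split; [apply: fB; exists x|exact: nuB].
move=> x x' w Ax Ax' -> [/f_inj hx /nu_inj gx].
have {}hx : h x = h x' by apply: hx; [exists x|exists x'].
by apply: (gP (h x)) => //; rewrite gx// hx.
Qed.

Lemma card_aleph_infinite (T : Type) n (A : set T) :
  card_aleph n A -> infinite_set A.
Proof.
elim: n A => /= [A|n IHn A [B [BA /IHn Binf _ _]]].
  by rewrite infiniteP card_eq_sym => /card_eqPle[].
exact: sub_infinite_set Binf.
Qed.

(** * Monochromatic cubes *)

Section Cubes.
Variables (T : choiceType) (V : zmodType) (psi : T -> V).

(** Choices are indexed by all of [nat], so that passing to the tail of [s] is composition with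
    [S]. *)
Definition vertex (e : nat -> bool) (s : seq (T * T)) : V :=
  \sum_(i < size s)
    psi (if e i then (tnth (in_tuple s) i).1 else (tnth (in_tuple s) i).2).

Lemma vertex_cons e p s :
  vertex e (p :: s) = psi (if e 0%N then p.1 else p.2) + vertex (e \o S) s.
Proof.
rewrite /vertex big_ord_recl; congr (psi _ + _); apply: eq_bigr => i _.
by rewrite !(tnth_nth p).
Qed.

(** Finiteness is assumed at every [v] so that the hypothesis passes to the colouring translated by
    [psi b], to which the induction applies. *)
Lemma monochromatic_cube n (B : set T) (C : Type) (c : V -> C) :
  card_aleph n B ->
  (forall v, finite_set ((fun b => c (psi b + v)) @` B)) ->
  exists s : seq (T * T), [/\ size s = n.+1,
    forall p, p \in s -> [/\ B p.1, B p.2 & p.1 <> p.2] &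
    forall e e', c (vertex e s) = c (vertex e' s)].
Proof.
have pigeon (A : set T) (c' : V -> C) v : infinite_set A ->
    finite_set ((fun b => c' (psi b + v)) @` A) ->
    exists a a', [/\ A a, A a', a <> a' & c' (psi a + v) = c' (psi a' + v)].
  move=> Ainf fin; apply: contrapT => noa; apply: Ainf.
  apply: card_le_finite fin.
  apply: (@card_le_rel _ _ _ _ (fun a k => k = c' (psi a + v))).
    by move=> a Aa; exists (c' (psi a + v)) => //; exists a.
  move=> a a' k Aa Aa' -> e; apply: contrapT => aa'.
  by apply: noa; exists a, a'.
elim: n B c => [|n IHn] B c Bn fin.
  have [a [a' [Ba Ba' aa' caa']]] :=
    pigeon B c 0 (card_aleph_infinite Bn) (fin 0).
  exists [:: (a, a')]; split=> // [p|e e'].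
    by rewrite inE => /eqP ->.
  rewrite !vertex_cons /= /vertex !big_ord0.
  by do 2 case: ifP.
have [B' [B'B B'n BB' _]] := Bn.
have B'inf := card_aleph_infinite B'n.
have /choice[S SP] : forall b, exists s : seq (T * T), B b ->
    [/\ size s = n.+1,
    forall p, p \in s -> [/\ B' p.1, B' p.2 & p.1 <> p.2] &
    forall e e', c (psi b + vertex e s) = c (psi b + vertex e' s)].
  move=> b; have [|s sP] := IHn B' (fun v => c (psi b + v)) B'n;
    last by exists s.
  move=> v; apply: sub_finite_set (fin (psi b + v)).
  by move=> _ [b' /B'B Bb' <-]; exists b' => //; rewrite addrCA.
(* There are at most as many finite sequences of pairs from [B'] as elements of [B'], so one cube
   serves infinitely many [b]. *)
have [|s sinf] := @infinite_fiber _ _ _ B B' S B'inf BB'.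
  apply: card_le_trans (card_seqs B'inf (card_le_square B'inf)).
  apply: subset_card_le => _ [b Bb <-] p pS.
  by have [_ /(_ _ pS)[]] := SP _ Bb.
pose v := vertex xpredT s.
have [|a [a' [[Ba Sa] [Ba' Sa'] aa' caa']]] := pigeon _ c v sinf.
  by apply: sub_finite_set (fin v); apply: image_subset; exact: subIsetl.
have [size_s sB' cs] := SP _ Ba.
have [_ _ cs'] := SP _ Ba'.
rewrite Sa in size_s sB' cs; rewrite Sa' in cs'.
exists ((a, a') :: s); split=> [|p|].
- by rewrite /= size_s.
- rewrite inE => /orP[/eqP -> //|/sB'[? ? ?]].
  by split => //; exact: B'B.
(* The faces over [a] and [a'] each have a single colour, and the two colours agree at the vertex
   [v]. *)
- have cE e : c (vertex e ((a, a') :: s)) = c (psi a + v).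
    rewrite vertex_cons /=; case: ifP => _; first exact: cs.
    by rewrite caa'; exact: cs'.
  by move=> e e'; rewrite !cE.
Qed.

End Cubes.

(** * Separated sets and density *)

Section RealScaling.
Variables (R : realType) (k : scalar_kind).

Lemma scalar_of1 : scalar_of k (1 : R) = 1.
Proof. by case: k. Qed.

Lemma scalar_ofK : cancel (@scalar_of R k) (@scalar_re R k).
Proof. by case: k. Qed.

Lemma rnormN (V : normedZmodType (scalars R k)) (v : V) : rnorm (- v) = rnorm v.
Proof. by rewrite /rnorm normrN. Qed.

Lemma rnorm_scalar_of (r : R) : 0 <= r -> rnorm (scalar_of k r) = r.
Proof.
move=> r0; rewrite /rnorm ger0_norm ?scalar_ofK//.
by rewrite -(scalar_of0 R k) le_scalar_of.
Qed.

Lemma rnormZ (V : normedModType (scalars R k)) (a : scalars R k) (v : V) :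
  rnorm (a *: v) = rnorm a * rnorm v.
Proof.
by apply: (@scalar_of_inj R k); rewrite scalar_ofM !rnormK normrZ.
Qed.

Lemma scalar_of_scalerA (V : lmodType (scalars R k)) (r s : R) (v : V) :
  scalar_of k r *: (scalar_of k s *: v) = scalar_of k (r * s) *: v.
Proof. by rewrite scalerA scalar_ofM. Qed.

End RealScaling.

Lemma lt_pow2 (R : realType) (r : R) : exists n : nat, r < 2 ^+ n.
Proof.
exists (Num.bound r); apply: le_lt_trans (ler_norm r) _.
apply: lt_trans (archi_boundP (normr_ge0 r)) _.
rewrite -natrX ltr_nat.
have -> : Num.bound `|r| = Num.bound r by rewrite /Num.bound normr_id.
exact: ltn_expl.
Qed.

Section Density.
Variables (R : realType) (k : scalar_kind) (X : normedModType (scalars R k)).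

Lemma dense_rnorm (E : set X) :
  (forall (x : X) (e : R), 0 < e -> exists2 y, E y & rnorm (x - y) < e) ->
  dense E.
Proof.
move=> EX O [x Ox] oO.
have /nbhs_ballP[e /= e0 eO] : nbhs x O by apply: open_nbhs_nbhs; split.
(* Radii of balls are scalars; [rnorm e] is the radius as a real number. *)
have re0 : 0 < rnorm e.
  rewrite lt0r rnorm_ge0 andbT; apply/eqP => /rnorm0_eq0 e00.
  by rewrite e00 ltxx in e0.
have [y Ey xy] := EX x _ re0.
exists y; split=> //; apply: eO; rewrite -ball_normE /=.
rewrite -(gtr0_norm e0) -!rnormK lt_neqAle le_scalar_of (ltW xy) andbT.
by apply/eqP => /scalar_of_inj xye; rewrite xye ltxx in xy.
Qed.

Definition separated (A : set X) := A `<=` [set x | rnorm x <= 1] /\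
  forall a b, A a -> A b -> a <> b -> 2^-1 <= rnorm (a - b).

(** By Zorn's lemma; a point of the unit ball farther than 1/2 from a maximal separated set could be
    added to it. *)
Lemma maximal_separated : exists A : set X, separated A /\
  forall x, rnorm x <= 1 -> exists2 a, A a & rnorm (x - a) <= 2^-1.
Proof.
have [|A [sepA Amax]] := @Zorn_bigcup _ separated.
  move=> F FP Ftot; split=> [|a b [Y FY Ya] [Z FZ Zb]].
    by apply: bigcup_sub => Y /FP[].
  have [YZ|ZY] := Ftot _ _ FY FZ.
    by apply: (FP _ FZ).2 => //; exact: YZ.
  by apply: (FP _ FY).2 => //; exact: ZY.
exists A; split => // x x1; apply: contrapT => nx.
have xA a : A a -> 2^-1 <= rnorm (x - a).
  move=> Aa; rewrite leNgt; apply/negP => xa.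
  by apply: nx; exists a => //; exact: ltW.
have xnA : ~ A x by move=> /xA; rewrite subrr rnorm0 leNgt invr_gt0 ltr0n.
apply: (Amax (x |` A)).
  by split; [exact: subsetUr|move=> /(_ x (or_introl erefl))].
split=> [_ [->//|/sepA.1//]|a b [->|Aa] [->|Ab] ab] //.
- exact: xA.
- by rewrite -rnormN opprB; exact: xA.
- exact: sepA.2.
Qed.

(* [:: a_0; ...; a_m] is mapped to the sum of the 2^-i a_i. *)
Definition dyadic_sum (s : seq X) : X :=
  foldr (fun a v => a + scalar_of k 2^-1 *: v) 0 s.

(** If [a] is within 1/2 of [x], then [2 (x - a)] is again in the unit ball and can be approximated
    in turn. *)
Lemma dyadic_sum_approx (A : set X) :
  (forall x, rnorm x <= 1 -> exists2 a, A a & rnorm (x - a) <= 2^-1) ->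
  forall m x, rnorm x <= 1 ->
  exists2 s, seqs A s & rnorm (x - dyadic_sum s) <= 2^-1 ^+ m.
Proof.
move=> AX; elim=> [|m IHm] x x1; first by exists [::] => //=; rewrite subr0.
have [a Aa xa] := AX _ x1.
have y1 : rnorm (scalar_of k 2 *: (x - a)) <= 1.
  by rewrite rnormZ rnorm_scalar_of// -ler_pdivlMl// mulr1.
have [s sA ys] := IHm _ y1.
exists (a :: s) => [b|/=]; first by rewrite inE => /orP[/eqP ->//|/sA].
have -> : x - (a + scalar_of k 2^-1 *: dyadic_sum s) =
    scalar_of k 2^-1 *: (scalar_of k 2 *: (x - a) - dyadic_sum s).
  by rewrite scalerBr scalar_of_scalerA mulVf// scalar_of1 scale1r opprD addrA.
by rewrite rnormZ rnorm_scalar_of ?invr_ge0// exprS ler_pM2l// invr_gt0.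
Qed.

(** The multiples by powers of 2 of dyadic sums over [A] are dense, and there are at most as many as
    elements of [W]. *)
Lemma card_dense_le (A : set X) (U : Type) (W : set U) (D : set X) :
  (forall x, rnorm x <= 1 -> exists2 a, A a & rnorm (x - a) <= 2^-1) ->
  attains_dens D -> infinite_set W -> A #<= W -> D #<= W.
Proof.
move=> AX [_ Dmin] Winf AW.
pose h (t : nat * seq X) : X := scalar_of k (2 ^+ t.1) *: dyadic_sum t.2.
have hdense : dense (h @` (setT `*` seqs A)).
  apply: dense_rnorm => x e e0.
  (* Division by [2 ^+ n] brings [x] into the unit ball; [m] makes the rescaled error
     [2 ^+ n * 2^-1 ^+ m] less than [e]. *)
  have [n /ltW xn] := lt_pow2 (rnorm x).
  have [m em] := lt_pow2 (2 ^+ n / e).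
  rewrite ltr_pdivrMr// mulrC -ltr_pdivrMr ?exprn_gt0// -exprVn in em.
  have y1 : rnorm (scalar_of k (2 ^+ n)^-1 *: x) <= 1.
    rewrite rnormZ rnorm_scalar_of ?invr_ge0 ?exprn_ge0//.
    by rewrite ler_pdivrMl ?exprn_gt0// mulr1.
  have [s sA ys] := dyadic_sum_approx AX m y1.
  exists (h (n, s)); first by exists (n, s).
  have -> : x - h (n, s) =
      scalar_of k (2 ^+ n) *: (scalar_of k (2 ^+ n)^-1 *: x - dyadic_sum s).
    by rewrite scalerBr scalar_of_scalerA mulfV ?expf_neq0// scalar_of1 scale1r.
  rewrite rnormZ rnorm_scalar_of ?exprn_ge0//.
  by apply: le_lt_trans em; rewrite ler_pM2l ?exprn_gt0.
apply: card_le_trans (Dmin _ hdense) _.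
apply: card_le_trans (card_image_le _ _) _.
apply: card_le_trans (card_le_square Winf).
have [w0 _] := infinite_setN0 Winf.
have [f [fW f_inj]] := card_le_fun w0 (card_seqs Winf AW).
have [nu [nuW nu_inj]] := card_le_fun w0 ((infiniteP _).1 Winf).
apply: (@card_le_rel _ _ _ _ (fun t w => w = (nu t.1, f t.2))).
  move=> [n s] [/= _ sA]; eexists; last reflexivity.
  by split; [exact: nuW|exact: fW].
move=> [n s] [n' s'] _ [/= _ sA] [_ sA'] -> [/(nu_inj _ _ I I) -> /f_inj].
by move=> ->.
Qed.

(** A maximal separated set is infinite, since otherwise [D] would be countable while [B] is not;
    hence it has at least as many elements as [D]. *)
Lemma card_aleph_separated (D : set X) (n : nat) (B : set X) :
  attains_dens D -> B `<=` D -> card_aleph n.+1 B ->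
  exists psi : X -> X, (forall b, B b -> rnorm (psi b) <= 1) /\
    forall b b', B b -> B b' -> b <> b' -> 2^-1 <= rnorm (psi b - psi b').
Proof.
move=> Ddens BD Bn.
have [A [sepA AX]] := maximal_separated.
have BA : B #<= A.
  apply: (card_le_trans (subset_card_le BD)).
  apply: (card_dense_le AX Ddens) => // Afin.
  have [B' [_ /card_aleph_infinite/infiniteP B'inf BB' _]] := Bn.
  apply: BB'; apply: card_le_trans B'inf.
  apply: card_le_trans (subset_card_le BD) _.
  apply: (card_dense_le AX Ddens); first exact: infinite_nat.
  exact: finite_set_countable.
have [psi [psiA psi_inj]] := card_le_fun 0 BA.
exists psi; split=> [b /psiA/sepA.1//|b b' Bb Bb' bb'].
by apply: sepA.2; [exact: psiA|exact: psiA|move=> /(psi_inj _ _ Bb Bb')].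
Qed.

End Density.

(** * Rounding in c0 *)

(** Induction on an enumeration of [F]: such a function is determined by its value at the head and
    its restriction to the tail. *)
Lemma finite_set_supported (I T : Type) (F : set I) (d : T) (Q : set T) :
  finite_set F -> finite_set Q ->
  finite_set [set h : I -> T |
    (forall i, ~ F i -> h i = d) /\ (forall i, F i -> Q (h i))].
Proof.
move=> Ffin Qfin; elim/Pchoice: I => I in F Ffin *.
have [r rF] : exists r : seq I, F = [set i | i \in r] by exact/finite_seqP.
rewrite {F Ffin}rF; elim: r => [|j r IHr].
  apply: (@sub_finite_set _ _ [set fun=> d]); last exact: finite_set1.
  by move=> h [hd _]; apply/funext => i; exact: hd.
pose upd (t : T * (I -> T)) : I -> T := fun i => if i == j then t.1 else t.2 i.
apply: sub_finite_set (finite_image upd (finite_setX Qfin IHr)).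
move=> h [hd hQ]; exists (h j, fun i => if i \in r then h i else d).
  split=> /=; first by apply: hQ; rewrite /= mem_head.
  split=> i /=; first by case: ifP.
  by move=> ir; rewrite ir; apply: hQ; rewrite /= inE ir orbT.
apply/funext => i; rewrite /upd /=; case: eqP => [->//|/eqP ij].
by case: ifP => // ir; rewrite hd//= inE (negbTE ij) ir.
Qed.

Section Rounding.
Variables (R : realType) (k : scalar_kind).

Definition scalar_im (a : scalars R k) : R :=
  (match k return scalars R k -> R with
   | RealScalars => fun=> 0
   | ComplexScalars => fun a => complex.Im a
   end) a.

Lemma scalar_imB a b : scalar_im (a - b) = scalar_im a - scalar_im b.
Proof.
by rewrite /scalar_im; case: k a b => [a b|[? ?] [? ?]] //; rewrite subrr.
Qed.

Lemma scalar_reB (a b : scalars R k) :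
  scalar_re (a - b) = scalar_re a - scalar_re b.
Proof. by case: k a b => // -[? ?] [? ?]. Qed.

Lemma scalar_parts_le (a : scalars R k) :
  `|scalar_re a| <= rnorm a /\ `|scalar_im a| <= rnorm a.
Proof.
rewrite /rnorm /scalar_im; case: k a => [a /=|[x y] /=];
  first by rewrite normr0.
rewrite -[leLHS]sqrtr_sqr -[X in _ /\ X <= _]sqrtr_sqr.
by rewrite !ler_wsqrtr// ?lerDl ?lerDr sqr_ge0.
Qed.

Lemma rnorm_le_parts (a : scalars R k) :
  rnorm a <= `|scalar_re a| + `|scalar_im a|.
Proof.
rewrite /rnorm /scalar_im; case: k a => [a /=|[x y] /=];
  first by rewrite normr0 addr0.
rewrite -[leRHS]ger0_norm ?addr_ge0// -sqrtr_sqr ler_wsqrtr//.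
rewrite -(real_normK (num_real x)) -(real_normK (num_real y)) sqrrD.
by rewrite addrAC lerDl mulrn_wge0 ?mulr_ge0.
Qed.

Variables (Gamma : Type) (K : R).

(** The threshold [3 * K] leaves a margin [K] above [2 * K], which makes the colouring finite on
    balls of radius [K], while two coordinates coloured [None] differ by at most [6 * K]. *)
Definition rounding (y : c0 R k Gamma) : Gamma -> option (int * int) := fun g =>
  if rnorm (y g) <= 3 * K then None
  else Some (Num.floor (scalar_re (y g) / K), Num.floor (scalar_im (y g) / K)).

Hypothesis K0 : 0 < K.

Lemma floor_eq_dist (r s : R) :
  Num.floor (r / K) = Num.floor (s / K) -> `|r - s| <= K.
Proof.
move=> e; have /andP[r1 r2] := floor_itv (r / K).
have /andP[s1 s2] := floor_itv (s / K).
rewrite e intrD in r1 r2; rewrite intrD in s2.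
have -> : r - s = (r / K - s / K) * K by rewrite mulrBl !divfK ?gt_eqF.
rewrite normrM (gtr0_norm K0); apply: ler_piMl; first exact: ltW.
rewrite ler_norml.
by apply/andP; split; lra.
Qed.

Lemma rounding_eq_dist (y y' : c0 R k Gamma) :
  rounding y = rounding y' -> normdist y y' <= 6 * K.
Proof.
move=> e; rewrite /normdist rnorm_c0E; apply: supnorm_le => [|g].
  by rewrite mulr_ge0// ltW.
change (rnorm (y g - y' g) <= 6 * K).
have := congr1 (@^~ g) e; rewrite /rounding /=.
case: ifP => yg; case: ifP => yg' //.
  move=> _; apply: le_trans (rnormD _ _) _; rewrite rnormN; lra.
move=> [] /floor_eq_dist + /floor_eq_dist.
rewrite -scalar_reB -scalar_imB => re im.
apply: le_trans (rnorm_le_parts _) _; have := K0; lra.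
Qed.

(** Only finitely many coordinates of [y0] exceed [2 * K]. At all others every [y] in the ball
    rounds to [None]; at these the integers obtained are bounded. *)
Lemma finite_rounding_ball (y0 : c0 R k Gamma) :
  finite_set (rounding @` [set y | normdist y y0 <= K]).
Proof.
pose M : R := (supnorm y0 + K) / K.
have M0 : 0 <= M by rewrite divr_ge0 ?addr_ge0 ?supnorm_ge0 ?ltW.
pose N := Num.bound M.
(* [J] consists of the integers from [-N] to [N - 1], the possible floors of reals of absolute value
   less than [N]. *)
pose J : set int := (fun n : nat => n%:Z - N%:Z) @` `I_(2 * N).
have Jfin : finite_set J by apply: finite_image; exact: finite_II.
have /asboolP/(_ (2 * K)) F : vanishing y0 by case: (y0).
apply: sub_finite_set (@finite_set_supported _ _ _ None
   (None |` some @` (J `*` J)) (F _) _); last 2 first.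
- by rewrite mulr_gt0.
- rewrite finite_setU; split; first exact: finite_set1.
  by apply: finite_image; exact: finite_setX.
have inJ r : `|r| <= supnorm y0 + K -> J (Num.floor (r / K)).
  move=> rM; have : `|r / K| < N%:R.
    apply: le_lt_trans (archi_boundP M0).
    by rewrite normrM normfV (gtr0_norm K0) ler_pM2r// invr_gt0.
  rewrite ltr_norml => /andP[/ltW]; rewrite -[N%:R]/((N%:Z)%:~R) -intrN.
  rewrite -floor_ge_int -floor_lt_int => zN Nz.
  move: (Num.floor _) zN Nz => z zN Nz.
  by exists (absz (z + N%:Z)) => /=; lia.
move=> _ [y yy0 <-].
have yg g : rnorm (y g) <= rnorm (y0 g) + K.
  have -> : y g = y0 g + (y - y0) g by rewrite addrC; exact/esym/subrK.
  apply: le_trans (rnormD _ _) _; rewrite lerD2l.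
  apply: le_trans yy0; rewrite /normdist rnorm_c0E; exact: le_supnorm.
split=> g /=; rewrite /rounding.
  move=> /negP; rewrite -leNgt => y0g; rewrite ifT//.
  apply: le_trans (yg g) _; lra.
case: ifP => [_|_ _]; first by left.
right; eexists; last reflexivity.
have [re im] := scalar_parts_le (y g).
have yM : rnorm (y g) <= supnorm y0 + K.
  by apply: le_trans (yg g) _; rewrite lerD2r le_supnorm.
by split; apply: inJ; [exact: le_trans re yM|exact: le_trans im yM].
Qed.

End Rounding.

(** * The cotype estimate *)

Section NonEmbedding.
Variables (R : realType) (k : scalar_kind) (X : normedModType (scalars R k)).

(** Cotype [q] bounds [(n * 2^-1]^ q) [^ q^-1] by [C * L], hence [n] by the [q]-th power of
    [2 * C * L], with [C] replaced by its absolute value. *)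
Lemma cotype_size_bound (L : R) : nontrivial_cotype X ->
  exists N : nat, forall n (x : 'I_n -> X),
    (forall i, 2^-1 <= rnorm (x i)) ->
    (forall e : {ffun 'I_n -> bool},
       rnorm (\sum_(i < n) (-1) ^+ e i *: x i) <= L) ->
    (n <= N)%N.
Proof.
move=> [q q2 [C cot]]; have q0 : 0 < q by apply: lt_le_trans q2.
pose B := ((2 * (`|C| * L)) `^ q : R).
exists (Num.bound B) => n x x2 xL.
have L0 : 0 <= L by apply: le_trans (xL [ffun=> true]); exact: rnorm_ge0.
rewrite -(ler_nat R); apply: ltW.
apply: le_lt_trans (archi_boundP (powR_ge0 _ _)).
have avg : (2 ^+ n)^-1 * (\sum_(e : {ffun 'I_n -> bool})
    rnorm (\sum_(i < n) (-1) ^+ e i *: x i) `^ q) <= L `^ q.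
  rewrite ler_pdivrMl ?exprn_gt0//.
  apply: (@le_trans _ _ (\sum_(e : {ffun 'I_n -> bool}) L `^ q)).
    by apply: ler_sum => e _; rewrite ge0_ler_powR ?nnegrE ?rnorm_ge0 ?(ltW q0).
  by rewrite sumr_const card_ffun card_bool card_ord -[leLHS]mulr_natl natrX.
have sum : n%:R * 2^-1 `^ q <= \sum_(i < n) rnorm (x i) `^ q.
  rewrite mulr_natl -{1}(card_ord n) -sumr_const; apply: ler_sum => i _.
  by rewrite ge0_ler_powR ?nnegrE ?rnorm_ge0 ?invr_ge0 ?(ltW q0).
have qV0 : 0 <= q^-1 by rewrite invr_ge0 ltW.
have powRqV (r : R) : 0 <= r -> (r `^ q) `^ q^-1 = r.
  by move=> r0; rewrite -powRrM mulfV ?gt_eqF// powRr1.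
have powRVq (r : R) : 0 <= r -> (r `^ q^-1) `^ q = r.
  by move=> r0; rewrite -powRrM mulVf ?gt_eqF// powRr1.
have nq : (n%:R * 2^-1 `^ q) `^ q^-1 <= `|C| * L.
  apply: (@le_trans _ _ ((\sum_(i < n) rnorm (x i) `^ q) `^ q^-1)).
    rewrite ge0_ler_powR ?nnegrE ?mulr_ge0 ?powR_ge0//.
    by rewrite sumr_ge0// => i _; exact: powR_ge0.
  apply: le_trans (cot n x) _.
  apply: (le_trans (ler_wpM2r (powR_ge0 _ _) (ler_norm C))).
  rewrite ler_wpM2l// -[leRHS]powRqV//.
  rewrite ge0_ler_powR ?nnegrE ?powR_ge0// mulr_ge0 ?invr_ge0 ?exprn_ge0//.
  by rewrite sumr_ge0// => e _; exact: powR_ge0.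
have : ((n%:R * 2^-1 `^ q) `^ q^-1) `^ q <= (`|C| * L) `^ q.
  by rewrite ge0_ler_powR ?nnegrE ?powR_ge0 ?mulr_ge0 ?(ltW q0).
rewrite powRVq ?mulr_ge0 ?powR_ge0// => nB.
have pow2K : 2^-1 `^ q * 2 `^ q = 1 :> R.
  by rewrite -powRM ?invr_ge0// mulVf ?powR1.
rewrite {}/B powRM ?mulr_ge0// [leRHS]mulrC.
have -> : n%:R = n%:R * 2^-1 `^ q * 2 `^ q :> R by rewrite -mulrA pow2K mulr1.
by rewrite ler_wpM2r ?powR_ge0.
Qed.

Lemma signed_sums_bounded (Gamma : Type) (g : X -> c0 R k Gamma) (K L : R) :
  dens_ge_aleph_omega X -> 0 < K ->
  (forall x y, normdist x y <= 1 -> normdist (g x) (g y) <= K) ->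
  (forall x y, normdist (g x) (g y) <= 6 * K -> normdist x y <= L) ->
  forall N : nat, exists n (x : 'I_n -> X), [/\ (N < n)%N,
    forall i, 2^-1 <= rnorm (x i) &
    forall e : {ffun 'I_n -> bool},
      rnorm (\sum_(i < n) (-1) ^+ e i *: x i) <= L].
Proof.
move=> [D [Ddens [A AD [Aalephs _]]]] K0 gK gL N.
(* A set of cardinality aleph_(N+1) yields cubes of dimension [N + 2]. *)
have [B BA Bn] := Aalephs N.+1.
have [psi [psi1 psi2]] := card_aleph_separated Ddens (subset_trans BA AD) Bn.
have [v|s [size_s sB sc]] :=
  monochromatic_cube (psi := psi) (c := rounding K \o g) Bn.
  apply: sub_finite_set (finite_rounding_ball K0 (g v)).
  move=> _ [b Bb <-]; exists (g (psi b + v)) => //=; apply: gK.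
  by rewrite /normdist addrK; exact: psi1.
pose t := in_tuple s.
exists (size s), (fun i => psi (tnth t i).2 - psi (tnth t i).1); split.
- by rewrite size_s.
- move=> i; have [B1 B2 B12] := sB _ (mem_tnth i t).
  by apply: psi2 => // /esym.
(* [e1] extends [e] to [nat] by an arbitrary value; it and its negation give antipodal vertices. *)
move=> e; pose e1 i := if insub i is Some j then e j else true.
have e1E (i : 'I_(size s)) : e1 i = e i by rewrite /e1 valK.
have := gL _ _ (rounding_eq_dist K0 (sc e1 (negb \o e1))).
congr (_ <= _); rewrite /normdist /vertex -sumrB; congr rnorm.
apply: eq_bigr => i _ /=; rewrite e1E -/t.
by case: (e i) => /=; rewrite ?expr1 ?expr0 ?scale1r// scaleN1r opprB.
Qed.

(** The common core of both cases: control of [g] at a single scale in each direction is already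
    contradictory. *)
Lemma no_c0_embedding (Gamma : Type) (g : X -> c0 R k Gamma) (K L : R) :
  nontrivial_cotype X -> dens_ge_aleph_omega X -> 0 < K ->
  (forall x y, normdist x y <= 1 -> normdist (g x) (g y) <= K) ->
  ~ (forall x y, normdist (g x) (g y) <= 6 * K -> normdist x y <= L).
Proof.
move=> X_cotype X_dens K0 gK gL.
have [N nN] := cotype_size_bound L X_cotype.
have [n [x [Nn x2 xL]]] := signed_sums_bounded X_dens K0 gK gL N.
by have := nN _ _ x2 xL; rewrite leqNgt Nn.
Qed.

End NonEmbedding.

(** * Uniform and coarse embeddings *)

Theorem corollary21 (R : realType) (k : scalar_kind)
    (X : normedModType (scalars R k))
    (X_cotype : nontrivial_cotype X)
    (X_dens : dens_ge_aleph_omega X) :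
  (forall Gamma : Type, ~ exists f : X -> c0 R k Gamma,
     uniform_embedding (@normdist R k X) (@normdist R k (c0 R k Gamma)) f) /\
  (forall Gamma : Type, ~ exists f : X -> c0 R k Gamma,
     coarse_embedding (@normdist R k X) (@normdist R k (c0 R k Gamma)) f).
Proof.
split=> Gamma [f].
  move=> [_ f_unif finv_unif].
  have [r r0 fr] := finv_unif 1 ltr01.
  (* With [K = r / 7], images within [6 * K] are closer than [r], so their arguments are closer than
     1. *)
  have K0 : 0 < r / 7 by rewrite divr_gt0.
  have [d d0 fd] := f_unif _ K0.
  (* Scaling by [d / 2] turns distances at most 1 into distances less than [d]. *)
  have s0 : 0 < d / 2 by rewrite divr_gt0.
  pose s := scalar_of k (d / 2).
  have rs (x y : X) : normdist (s *: x) (s *: y) = d / 2 * normdist x y.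
    by rewrite /normdist -scalerBr rnormZ rnorm_scalar_of// ltW.
  pose g (x : X) := f (s *: x).
  apply: (@no_c0_embedding _ _ _ _ g (r / 7) (d / 2)^-1) => //.
    move=> x y xy; apply/ltW/fd; rewrite rs.
    have := ler_pM2l s0 (normdist x y) 1; rewrite xy; lra.
  move=> x y xy; rewrite -[leRHS]mulr1 ler_pdivlMl// -rs; apply/ltW/fr.
  by apply: le_lt_trans xy _; lra.
move=> [f_bdd f_exp].
have [K K0 fK] := f_bdd 1 ltr01.
(* [K + 1] replaces [K], which may be 0. Points at distance at least [d] have images at least
   [7 * (K + 1)] apart, more than [6 * (K + 1)]. *)
have K1 : 0 < K + 1 by rewrite ltr_wpDl.
have K7 : 0 < 7 * (K + 1) by rewrite mulr_gt0.
have [d d0 fd] := f_exp _ K7.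
apply: (@no_c0_embedding _ _ _ _ f (K + 1) d) => //.
  by move=> x y /fK fxy; apply: le_trans fxy _; rewrite lerDl.
move=> x y xy; rewrite leNgt; apply/negP => /ltW/fd fxy.
have := le_trans fxy xy; lra.
Qed.
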